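(* Let $\Phi:(\mathcal{S},g)\to(\mathcal{M},\bar g)$ be an isometric immersion of an $n$-dimensional Riemannian manifold into a semi-Riemannian manifold with co-dimension $2$. If, at a point, $\mathcal{S}$ is umbilical with respect to a normal direction (i.e. with respect to some non-zero normal vector), then such a direction is unique and it is spanned by $\star^\perp G$, unless $G=0$, in which case $\mathcal{S}$ is totally umbilical there. Here $G$ is the normal vector, determined up to sign, for which there is a self-adjoint operator $\widetilde A$ on the tangent space with $\mathrm{tr}(\widetilde A^2)=n^2$ and $\widetilde h(X,Y)=g(\widetilde A X,Y)\,G$ for all tangent vectors $X,Y$.
   Context: $\mathcal{S}$ is an orientable $n$-manifold, $\mathcal{M}$ an oriented semi-Riemannian $(n+2)$-manifold with metric $\bar g$, and $g=\Phi^\star\bar g$ is positive definite; $\mathcal{S}$ is locally identified with $\Phi(\mathcal{S})$. The normal bundle may have any signature. $\overline\nabla,\nabla$ are the Levi-Civita connections of $\bar g,g$. The second fundamental form $h$ is the normal part of $\overline\nabla_XY$: $\overline\nabla_XY=\nabla_XY+h(X,Y)$. The shape operator $A_\xi$ is defined by $g(A_\xi X,Y)=\bar g(h(X,Y),\xi)$. The mean curvature vector is $H=\frac1n\sum_{i=1}^n h(e_i,e_i)$ for an orthonormal tangent frame, and the total shear tensor is $\widetilde h(X,Y)=h(X,Y)-g(X,Y)H$. $\mathcal{S}$ is umbilical with respect to a normal vector $\xi$ if $A_\xi$ is proportional to the identity (this depends only on the direction span$(\xi)$), and totally umbilical if this holds for all normal $\xi$ (equivalently $\widetilde h=0$). With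 $\omega^\perp$ the volume form on the normal bundle induced by the orientations and metrics of $\mathcal{M}$ and $\mathcal{S}$, the Hodge dual $\star^\perp\xi$ of a normal $\xi$ is defined by $\bar g(\star^\perp\xi,\eta)=\omega^\perp(\xi,\eta)$ for all normal $\eta$. When $\mathcal{S}$ is umbilical with respect to some non-zero normal vector at a point, a pair $(\widetilde A,G)$ as in the claim exists there. *)

(* Defs.v *)
From HB Require Import structures.
From mathcomp Require Import all_boot all_order all_algebra.
From mathcomp Require Import all_classical all_reals all_analysis.
From mathcomp Require Import ring lra.

Set Implicit Arguments.
Unset Strict Implicit.
Unset Printing Implicit Defensive.

Import Order.TTheory GRing.Theory Num.Theory.
Import numFieldNormedType.Exports.

Local Open Scope classical_set_scope.
Local Open Scope ring_scope.

(* Vectors of R^n are row vectors and matrices act on the right, so the       *)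
(* bilinear form with Gram matrix G is (u, v) |-> u G v^T.                    *)
Definition bil (R : pzRingType) n (G : 'M[R]_n) (u v : 'rV[R]_n) : R :=
  (u *m G *m v^T) 0 0.

Section Calculus.
Variable R : realType.

Definition partial n (i : 'I_n) (f : 'rV[R]_n -> R) (x : 'rV[R]_n) : R :=
  'D_(delta_mx 0 i) (f : 'rV[R]_n -> R^o) x.

Fixpoint Ck n (k : nat) (U : set 'rV[R]_n) (f : 'rV[R]_n -> R) : Prop :=
  (forall x, U x -> {for x, continuous f}) /\
  if k is k'.+1 then
    forall i : 'I_n,
      (forall x, U x -> derivable (f : 'rV[R]_n -> R^o) x (delta_mx 0 i)) /\
      Ck k' U (partial i f)
  else True.

Definition smooth_on n (U : set 'rV[R]_n) (f : 'rV[R]_n -> R) : Prop :=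
  forall k, Ck k U f.

(* Jacobian matrix: row i is the i-th partial derivative of F. *)
Definition jac n m (F : 'rV[R]_n -> 'rV[R]_m) (x : 'rV[R]_n) : 'M[R]_(n, m) :=
  \matrix_(i, j) partial i (fun y => F y 0 j) x.

End Calculus.

(* An oriented smooth manifold of dimension n: a Hausdorff second countable   *)
(* space with an indexed smooth atlas whose transition maps have positive     *)
(* Jacobian determinant.  crdV c is the inverse of the chart crd c; both are  *)
(* total functions, whose values outside dom c and its image are irrelevant.  *)
Record manifold (R : realType) (n : nat) := Manifold {
  carrier :> topologicalType;
  chart : Type;
  dom : chart -> set carrier;
  crd : chart -> carrier -> 'rV[R]_n;
  crdV : chart -> 'rV[R]_n -> carrier;
  manifold_hausdorff : hausdorff_space carrier;
  manifold_countable : @second_countable carrier;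
  dom_cover : forall p, exists c, dom c p;
  dom_open : forall c, open (dom c);
  img_open : forall c, open (crd c @` dom c);
  crdK : forall c p, dom c p -> crdV c (crd c p) = p;
  crd_continuous : forall c p, dom c p -> {for p, continuous (crd c)};
  crdV_continuous :
    forall c x, (crd c @` dom c) x -> {for x, continuous (crdV c)};
  transition_smooth : forall c d j,
    smooth_on (crd c @` (dom c `&` dom d)) (fun x => crd d (crdV c x) 0 j);
  transition_oriented : forall c d p, dom c p -> dom d p ->
    0 < \det (jac (crd d \o crdV c) (crd c p))
}.

Arguments dom {R n m} : rename.
Arguments crd {R n m} : rename.
Arguments crdV {R n m} : rename.

(* A semi-Riemannian metric, given by its Gram matrices in the charts.        *)
(* gram_sylvester says that each of them is symmetric and non-degenerate,     *)
(* with the same number of negative squares at all points.                    *)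
Record metric (R : realType) (n : nat) (M : manifold R n) := Metric {
  gram : chart M -> 'rV[R]_n -> 'M[R]_n;
  metric_index : nat;
  metric_index_le : (metric_index <= n)%N;
  gram_smooth : forall c i j,
    smooth_on (crd c @` dom c) (fun x => gram c x i j);
  gram_sylvester : forall c p, dom c p ->
    exists2 P : 'M[R]_n, P \in unitmx &
      P *m gram c (crd c p) *m P^T =
      diag_mx (\row_(i < n) (-1) ^+ (i < metric_index)%N);
  gram_change : forall c d p, dom c p -> dom d p ->
    let J := jac (crd d \o crdV c) (crd c p) in
    gram c (crd c p) = J *m gram d (crd d p) *m J^T
}.

Definition gram_at (R : realType) n (M : manifold R n) (g : metric M)
  (c : chart M) (p : M) : 'M[R]_n := gram g c (crd c p).

Definition riemannian (R : realType) n (M : manifold R n) (g : metric M) :=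
  forall (c : chart M) (p : M), dom c p ->
  forall v : 'rV[R]_n, v != 0 -> 0 < bil (gram_at g c p) v v.

Section LeviCivita.
Variables (R : realType) (n : nat) (G : 'rV[R]_n -> 'M[R]_n).

(* Coefficients of the Levi-Civita connection of the metric with Gram matrix  *)
(* G, in one chart: nabla_{d_a} d_b = \sum_k (christoffel x a b k) d_k.       *)
Definition christoffel (x : 'rV[R]_n) (a b k : 'I_n) : R :=
  2^-1 * \sum_(l < n) invmx (G x) l k *
    (partial a (fun y => G y b l) x + partial b (fun y => G y a l) x
     - partial l (fun y => G y a b) x).

Definition christoffel_form (x u w : 'rV[R]_n) : 'rV[R]_n :=
  \row_k \sum_(a < n) \sum_(b < n) christoffel x a b k * u 0 a * w 0 b.

Lemma christoffel_torsion_free x a b k :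
  (forall i j l, partial l (fun y => G y i j) x = partial l (fun y => G y j i) x)
  -> christoffel x a b k = christoffel x b a k.
Proof.
move=> sym; rewrite /christoffel; congr (_ * _); apply: eq_bigr => l _.
by rewrite (sym a b) [X in X - _]addrC.
Qed.

Lemma christoffel_metric x a b k : G x \in unitmx ->
  (forall i j, G x i j = G x j i) ->
  (forall i j l, partial l (fun y => G y i j) x = partial l (fun y => G y j i) x)
  -> partial k (fun y => G y a b) x =
     \sum_(l < n) (christoffel x k a l * G x l b + christoffel x k b l * G x a l).
Proof.
move=> Gu Gs sym.
have lower i j r : \sum_(l < n) christoffel x i j l * G x l r = 2^-1 *
    (partial i (fun y => G y j r) x + partial j (fun y => G y i r) x
     - partial r (fun y => G y i j) x).
  pose D := \row_l (partial i (fun y => G y j l) x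
    + partial j (fun y => G y i l) x - partial l (fun y => G y i j) x).
  transitivity ((2^-1 *: (D *m invmx (G x)) *m G x) 0 r).
    rewrite mxE; apply: eq_bigr => l _; congr (_ * _).
    by rewrite !mxE; congr (_ * _); apply: eq_bigr => s _; rewrite !mxE mulrC.
  by rewrite -scalemxAl mulmxKV // !mxE.
rewrite big_split /= lower.
under [X in _ + X]eq_bigr do rewrite Gs.
rewrite lower (sym b a); lra.
Qed.

End LeviCivita.

(* coordinate expression of a map between manifolds *)
Definition local_rep (R : realType) n m (S : manifold R n) (M : manifold R m)
    (Phi : S -> M) (c : chart S) (d : chart M) : 'rV[R]_n -> 'rV[R]_m :=
  crd d \o Phi \o crdV c.

Record isometric_immersion (R : realType) n m (S : manifold R n)
    (M : manifold R m) (g : metric S) (gb : metric M) := IsometricImmersion {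
  immersion_fun :> S -> M;
  immersion_continuous : continuous immersion_fun;
  immersion_smooth : forall c d j,
    smooth_on (crd c @` (dom c `&` immersion_fun @^-1` dom d))
              (fun x => local_rep immersion_fun c d x 0 j);
  immersion_injective : forall c d p, dom c p -> dom d (immersion_fun p) ->
    row_free (jac (local_rep immersion_fun c d) (crd c p));
  immersion_isometric : forall c d p, dom c p -> dom d (immersion_fun p) ->
    let J := jac (local_rep immersion_fun c d) (crd c p) in
    gram_at g c p = J *m gram_at gb d (immersion_fun p) *m J^T
}.

(* Extrinsic geometry at p.  Tangent vectors of S at p and of M at Phi p are  *)
(* given by their components in the charts c and d, and operators on the      *)
(* tangent space of S by matrices acting on the right.                        *)
Section Immersion.
Variables (R : realType) (n m : nat) (S : manifold R n) (M : manifold R m).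
Variables (g : metric S) (gb : metric M) (Phi : isometric_immersion g gb).
Variables (c : chart S) (d : chart M) (p : S).

Local Notation rep := (local_rep Phi c d).
Local Notation x0 := (crd c p).

Definition dPhi : 'M[R]_(n, m) := jac rep x0.

Definition tangent_form (X Y : 'rV[R]_n) : R := bil (gram_at g c p) X Y.

Definition ambient_form (v w : 'rV[R]_m) : R := bil (gram_at gb d (Phi p)) v w.

Definition normal (xi : 'rV[R]_m) : Prop :=
  forall X : 'rV[R]_n, ambient_form (X *m dPhi) xi = 0.

(* orthogonal projection on the normal space; see normal_partP *)
Definition normal_part (w : 'rV[R]_m) : 'rV[R]_m :=
  w - w *m gram_at gb d (Phi p) *m dPhi^T *m invmx (gram_at g c p) *m dPhi.

Lemma normal_partP (w : 'rV[R]_m) : gram_at g c p \in unitmx ->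
  gram_at g c p = dPhi *m gram_at gb d (Phi p) *m dPhi^T ->
  (gram_at gb d (Phi p))^T = gram_at gb d (Phi p) ->
  normal (normal_part w) /\ exists X, w = X *m dPhi + normal_part w.
Proof.
move=> gu gE gbs; split.
  move=> X; have -> : ambient_form (X *m dPhi) (normal_part w) =
      (normal_part w *m gram_at gb d (Phi p) *m dPhi^T *m X^T) 0 0.
    have tr11 (z : 'M[R]_1) : z 0 0 = z^T 0 0 by rewrite mxE.
    by rewrite /ambient_form /bil tr11 !trmx_mul trmxK gbs !mulmxA.
  rewrite /normal_part.
  set B := gram_at gb _ _ in gE gbs *; set a := _ *m invmx _.
  suff -> : (w - a *m dPhi) *m B *m dPhi^T = 0 by rewrite mul0mx mxE.
  by rewrite 2!mulmxBl -!(mulmxA a) -gE /a mulmxKV // subrr.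
exists (w *m gram_at gb d (Phi p) *m dPhi^T *m invmx (gram_at g c p)).
by rewrite /normal_part addrC subrK.
Qed.

(* covariant derivative, for the Levi-Civita connection of gb, of a vector    *)
(* field W along Phi in the direction X                                       *)
Definition nabla_along (X : 'rV[R]_n) (W : 'rV[R]_n -> 'rV[R]_m) : 'rV[R]_m :=
  X *m jac W x0 +
  christoffel_form (gram gb d) (rep x0) (X *m jac rep x0) (W x0).

(* Y is extended to the tangent field with constant components in c. *)
Definition second_form (X Y : 'rV[R]_n) : 'rV[R]_m :=
  normal_part (nabla_along X (fun x => Y *m jac rep x)).

Definition is_shape_operator (xi : 'rV[R]_m) (A : 'M[R]_n) : Prop :=
  forall X Y, tangent_form (X *m A) Y = ambient_form (second_form X Y) xi.

Definition umbilical (xi : 'rV[R]_m) : Prop :=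
  exists2 A, is_shape_operator xi A & exists a : R, A = a%:M.

Definition totally_umbilical : Prop := forall xi, normal xi -> umbilical xi.

(* c belongs to the oriented atlas of S, so positivity of the determinant     *)
(* means that the frame is positively oriented.                               *)
Definition oriented_orthonormal_frame (e : 'I_n -> 'rV[R]_n) : Prop :=
  (forall i j, tangent_form (e i) (e j) = (i == j)%:R) /\
  0 < \det (\matrix_(i < n) e i).

Definition mean_curvature (e : 'I_n -> 'rV[R]_n) : 'rV[R]_m :=
  n%:R^-1 *: \sum_(i < n) second_form (e i) (e i).

Definition total_shear (e : 'I_n -> 'rV[R]_n) (X Y : 'rV[R]_n) : 'rV[R]_m :=
  second_form X Y - tangent_form X Y *: mean_curvature e.

Definition self_adjoint (A : 'M[R]_n) : Prop :=
  forall X Y, tangent_form (X *m A) Y = tangent_form X (Y *m A).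

Definition shear_pair (e : 'I_n -> 'rV[R]_n) (A : 'M[R]_n) (G : 'rV[R]_m) :=
  [/\ self_adjoint A, \tr (A *m A) = n%:R ^+ 2, normal G &
      forall X Y, total_shear e X Y = tangent_form (X *m A) Y *: G].

End Immersion.

(* Hodge dual on the normal bundle in codimension 2.  In the oriented chart d *)
(* the volume form of M is sqrt |det gb| det, and the normal volume form is   *)
(* its contraction with a positively oriented orthonormal frame e of S.       *)
(* Listing the tangent vectors before or after the two normal ones gives the  *)
(* same sign.                                                                 *)
Section Hodge.
Variables (R : realType) (n : nat) (S : manifold R n) (M : manifold R (n + 2)).
Variables (g : metric S) (gb : metric M) (Phi : isometric_immersion g gb).
Variables (c : chart S) (d : chart M) (p : S) (e : 'I_n -> 'rV[R]_n).

Definition normal_volume (xi eta : 'rV[R]_(n + 2)) : R :=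
  Num.sqrt `|\det (gram_at gb d (Phi p))| *
  \det (col_mx ((\matrix_(i < n) e i) *m dPhi Phi c d p) (col_mx xi eta)
        : 'M[R]_(n + 2)).

Definition is_hodge_dual (xi s : 'rV[R]_(n + 2)) : Prop :=
  normal Phi c d p s /\
  forall eta, normal Phi c d p eta ->
    ambient_form Phi d p s eta = normal_volume xi eta.

End Hodge.

(* Main.v *)
(* A normal xi is umbilical exactly when the total shear is orthogonal to xi:  *)
(* tracing A_xi = a Id over an orthonormal frame gives a = <H, xi>.  In        *)
(* codimension 2 the normal vectors orthogonal to a non-zero normal vector     *)
(* form a line, whatever the signature.  Hence an umbilical direction confines *)
(* the total shear to a line, which yields G after rescaling by the trace      *)
(* condition, and conversely, if G != 0, the umbilical directions are the      *)
(* normal line orthogonal to G, which contains the non-zero vector *G.         *)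
(* Self-adjointness of the operator rests on the symmetry of the second        *)
(* fundamental form, i.e. on the equality of mixed partial derivatives, which  *)
(* is proved by applying the mean value theorem twice to a second difference.  *)

Require Import Defs.
From mathcomp Require Import all_boot all_order all_algebra.
From mathcomp Require Import all_classical all_reals all_analysis.
Import Order.TTheory GRing.Theory Num.Theory.
Import numFieldNormedType.Exports.
Local Open Scope ring_scope.

Set Implicit Arguments.
Unset Strict Implicit.
Unset Printing Implicit Defensive.

(** Write the total shear as a vector-valued bilinear form. Being umbilical along [xi] means that
    this form takes values orthogonal to [xi] ([umbilicalP]). The tangent space is non-degenerate,
    so the normal space is a non-degenerate plane, in which the orthogonal of a non-zero vector is a
    line, even for a null vector ([normal_orthogonal_line]). One umbilical direction therefore
    forces the shear to be a symmetric scalar form times a fixed normal vector. Raising an index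
    gives the operator, and the trace condition fixes the scale up to sign ([shear_pair_exists],
    [shear_pair_unique]).

    Since the trace condition makes the operator non-zero, [xi] is umbilical exactly when it is
    orthogonal to [G] ([umbilical_shear_pair]). If [G = 0] every normal vector qualifies. Otherwise
    the condition cuts out a line, and the Hodge dual of [G] spans it, being orthogonal to [G]
    ([hodge_dual_orthogonal]) and non-zero ([hodge_dual_neq0]). The only analytic input is the
    symmetry of the shear ([total_shear_bil]), which rests on [derive_comm]. *)

Lemma ler_dist_half (R : numFieldType) (e a b z : R) :
  `|a - z| < e / 2 -> `|b - z| < e / 2 -> `|a - b| <= e.
Proof.
move=> /ltW az /ltW bz; apply: le_trans (ler_distD z _ _) _.
by rewrite (splitr e) lerD// distrC.
Qed.

(** * Equality of mixed directional derivatives *)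

Section MixedDerivatives.
Variables (R : realType) (V : normedModType R).
Implicit Types (f : V -> R^o) (u v x y : V).

Lemma is_derive_line f u y (s : R) : derivable f (s *: u + y) u ->
  is_derive s 1 (fun r : R => f (r *: u + y) : R^o) ('D_u f (s *: u + y)).
Proof.
move=> df.
have E : (fun h : R => h^-1 *: (((fun r : R => f (r *: u + y) : R^o) \o shift s)
            (h *: 1) - f (s *: u + y)))
   = (fun h => h^-1 *: ((f \o shift (s *: u + y)) (h *: u) - f (s *: u + y))).
  by apply/funext => h /=; rewrite /shift /= scaler1 scalerDl addrA.
by split; [rewrite /derivable E | rewrite /derive E].
Qed.

Lemma mean_value_line f u y (h : R) : 0 <= h ->
  (forall t, t \in `[0, h] -> derivable f (t *: u + y) u) ->
  exists2 t, t \in `[0, h] & f (h *: u + y) - f y = 'D_u f (t *: u + y) * h.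
Proof.
move=> h0 df.
have [||t th] := @MVT_segment R (fun r => f (r *: u + y))
    (fun r => 'D_u f (r *: u + y)) 0 h h0.
- by move=> t th; apply/is_derive_line/df/subset_itv_oo_cc.
- apply: derivable_within_continuous => t /df /is_derive_line dft.
  exact: ex_derive.
by rewrite scale0r add0r subr0; exists t.
Qed.

Lemma is_derive_translate f u w y : derivable f (y + w) u ->
  is_derive y u (fun z => f (z + w)) ('D_u f (y + w)).
Proof.
move=> df.
have E : (fun h : R => h^-1 *: (((fun z => f (z + w)) \o shift y) (h *: u)
            - f (y + w)))
   = (fun h => h^-1 *: ((f \o shift (y + w)) (h *: u) - f (y + w))).
  by apply/funext => h /=; rewrite /shift /= addrA.
by split; [rewrite /derivable E | rewrite /derive E].
Qed.

(** The second difference is the increment along [u] of [f (z + h *: v) - f z]. One mean value step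
    turns it into an increment of ['D_u f] along [v], and a second step finishes. *)
Lemma second_difference f u v x (h : R) : 0 < h ->
  (forall s t, s \in `[0, h] -> t \in `[0, h] ->
    derivable f (t *: v + (s *: u + x)) u /\
    derivable ('D_u f) (t *: v + (s *: u + x)) v) ->
  exists s t, [/\ s \in `[0, h], t \in `[0, h] &
    f (h *: u + h *: v + x) - f (h *: u + x) - f (h *: v + x) + f x =
    'D_v ('D_u f) (t *: v + (s *: u + x)) * h ^+ 2].
Proof.
move=> h0 df; have h0' := ltW h0.
have h_in : h \in `[0, h] by rewrite in_itv /= h0' lexx.
have z_in : 0 \in `[0, h] by rewrite in_itv /= h0' lexx.
have dF s : s \in `[0, h] -> is_derive (s *: u + x) u
    ((fun z => f (z + h *: v)) - f)
    ('D_u f (s *: u + x + h *: v) - 'D_u f (s *: u + x)).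
  move=> sh; apply: is_deriveB.
    apply: is_derive_translate; rewrite addrC; exact: (df _ _ sh h_in).1.
  apply: derivableP; have := (df _ _ sh z_in).1.
  by rewrite scale0r add0r.
have [s sh Es] := @mean_value_line ((fun z => f (z + h *: v)) - f) u x h h0'
   (fun s sh => @ex_derive _ _ _ _ _ _ _ (dF s sh)).
have [t th Et] := @mean_value_line ('D_u f) v (s *: u + x) h h0'
   (fun t th => (df s t sh th).2).
exists s, t; split=> //.
rewrite expr2 mulrA -Et.
move: Es; rewrite (@derive_val _ _ _ _ _ _ _ (dF s sh)) !fctE.
rewrite (addrC (h *: v) (s *: u + x)) => <-.
by rewrite (addrAC _ x) (addrC x) opprD opprK !addrA.
Qed.

Lemma near_rectangle (P : set V) u v x : nbhs x P ->
  exists2 h : R, 0 < h & forall s t, s \in `[0, h] -> t \in `[0, h] ->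
    P (t *: v + (s *: u + x)).
Proof.
move=> /nbhs_normP[e /= e0 eP].
have k0 : 0 < `|u| + `|v| + 1 by rewrite ltr_wpDl ?addr_ge0.
(* The extra 1 covers [u = v = 0] and makes the final bound by [e] strict. *)
exists (e / (`|u| + `|v| + 1)); first by rewrite divr_gt0.
move=> s t; rewrite !in_itv /= => /andP[s0 sh] /andP[t0 th].
apply: eP; rewrite /ball_ /= distrC addrA addrK.
rewrite (le_lt_trans (ler_normD _ _))// !normrZ !ger0_norm//.
apply: (@le_lt_trans _ _ (e / (`|u| + `|v| + 1) * (`|u| + `|v|))).
  by rewrite mulrDr [leLHS]addrC lerD// ler_wpM2r.
by rewrite mulrAC ltr_pdivrMr// ltr_pM2l// ltrDl.
Qed.

(** The second difference is symmetric in [u] and [v], so the two mixed derivatives agree at two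
    possibly different points of a small parallelogram. Continuity brings both values within [e / 2]
    of those at [x]. *)
Lemma derive_comm f u v x :
  (\near x, [/\ derivable f x u, derivable f x v,
     derivable ('D_u f) x v & derivable ('D_v f) x u]) ->
  {for x, continuous ('D_v ('D_u f))} -> {for x, continuous ('D_u ('D_v f))} ->
  'D_v ('D_u f) x = 'D_u ('D_v f) x.
Proof.
move=> df /cvgrPdist_lt ca /cvgrPdist_lt cb.
apply/eqP; rewrite -subr_eq0 -normr_le0; apply/ler_addgt0Pr => e e0.
have e2 : 0 < e / 2 by rewrite divr_gt0.
set A := 'D_v ('D_u f) in ca *; set B := 'D_u ('D_v f) in cb *.
pose P := [set y | [/\ derivable f y u, derivable f y v,
     derivable ('D_u f) y v & derivable ('D_v f) y u] /\
   (`|A x - A y| < e / 2 /\ `|B x - B y| < e / 2)]%classic.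
have nP : nbhs x P by apply: filterI => //; apply: filterI; [exact: ca|exact: cb].
have [h h0 hP] := near_rectangle u v nP.
have hP' s t : s \in `[0, h] -> t \in `[0, h] -> P (t *: u + (s *: v + x)).
  by move=> sh th; rewrite addrCA; exact: hP.
have h20 : h ^+ 2 != 0 by rewrite expf_neq0 // gt_eqF.
have [s t sh th|s [t [sh th E]]] := @second_difference f u v x h h0.
  by have [[]] := hP s t sh th.
have [s' t' sh' th'|s' [t' [sh' th' E']]] := @second_difference f v u x h h0.
  by have [[]] := hP' s' t' sh' th'.
have {E'}E : A (t *: v + (s *: u + x)) = B (t' *: u + (s' *: v + x)).
  apply: (mulIf h20); apply: etrans (esym E) (etrans _ E').
  by rewrite (addrC (h *: v) (h *: u)); congr (_ + _); exact: addrAC.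
have [_ [+ _]] := hP s t sh th.
have [_ [_]] := hP' s' t' sh' th'; rewrite -E => HB HA.
rewrite add0r; exact: ler_dist_half HA HB.
Qed.

End MixedDerivatives.

(** * Bilinear forms given by Gram matrices *)

Section Bilinear.
Variables (R : comPzRingType) (n : nat) (B : 'M[R]_n).
Implicit Types u v w : 'rV[R]_n.

Lemma bilDl u v w : bil B (u + v) w = bil B u w + bil B v w.
Proof. by rewrite /bil !mulmxDl mxE. Qed.

Lemma bilZl a u w : bil B (a *: u) w = a * bil B u w.
Proof. by rewrite /bil -!scalemxAl mxE. Qed.

Lemma bilNl u w : bil B (- u) w = - bil B u w.
Proof. by rewrite -scaleN1r bilZl mulN1r. Qed.

Lemma bil_suml k (f : 'I_k -> 'rV[R]_n) w :
  bil B (\sum_i f i) w = \sum_i bil B (f i) w.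
Proof. by rewrite /bil !mulmx_suml summxE. Qed.

Lemma bilC u v : B^T = B -> bil B u v = bil B v u.
Proof.
move=> Bs; rewrite /bil -[in LHS]Bs -[u in LHS]trmxK -!trmx_mul mxE.
by rewrite mulmxA.
Qed.

Lemma bil_delta i j : bil B (delta_mx 0 i) (delta_mx 0 j) = B i j.
Proof. by rewrite /bil -rowE trmx_delta -colE !mxE. Qed.

Lemma bil_eq0 : (forall u v, bil B u v = 0) -> B = 0.
Proof. by move=> B0; apply/matrixP => i j; rewrite -bil_delta B0 mxE. Qed.

Lemma bil_mulmxl (K : 'M[R]_n) u v : bil B (u *m K) v = bil (K *m B) u v.
Proof. by rewrite /bil !mulmxA. Qed.

End Bilinear.

(** * Linear algebra of the normal space and, in codimension 2, of the normal plane *)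

Section NormalSpace.
Variables (F : fieldType) (n m : nat) (B : 'M[F]_m) (J : 'M[F]_(n, m)).
Hypotheses (Bs : B^T = B) (gu : J *m B *m J^T \in unitmx).

Lemma normal_mxP (xi : 'rV[F]_m) :
  (forall X, bil B (X *m J) xi = 0) <-> xi *m B *m J^T = 0.
Proof.
have E X : bil B (X *m J) xi = (xi *m B *m J^T *m X^T) 0 0.
  by rewrite bilC // /bil trmx_mul !mulmxA.
split=> [N|N X]; last by rewrite E N mul0mx mxE.
apply/rowP => i; rewrite [RHS]mxE -[RHS](N (delta_mx 0 i)) E.
by rewrite trmx_delta -colE [RHS]mxE.
Qed.

(** Pairing a linear relation with the tangent vectors kills its normal part. The invertible
    [J *m B *m J^T] then kills the tangential coefficients. *)
Lemma row_free_tangent_normal k (N : 'M[F]_(k, m)) :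
  N *m B *m J^T = 0 -> row_free N -> row_free (col_mx J N).
Proof.
move=> N0 fN; apply: inj_row_free => v.
rewrite -[v]hsubmxK; move: (lsubmx v) (rsubmx v) => u w {v}.
rewrite mul_row_col => E.
have : (u *m J + w *m N) *m B *m J^T = 0 by rewrite E !mul0mx.
rewrite !mulmxDl -!(mulmxA w) N0 mulmx0 addr0 -!(mulmxA u) => uE.
have u0 : u = 0.
  by apply: (can_inj (mulmxK gu)); rewrite mul0mx -uE !mulmxA.
move: E; rewrite u0 mul0mx add0r => wE.
suff -> : w = 0 by rewrite row_mx0.
by apply: (row_free_inj fN); rewrite mul0mx.
Qed.

End NormalSpace.

Section NormalPlane.
Variables (F : fieldType) (n : nat) (B : 'M[F]_(n + 2)) (J : 'M[F]_(n, n + 2)).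
Hypotheses (Bs : B^T = B) (Bu : B \in unitmx) (gu : J *m B *m J^T \in unitmx).
Implicit Types xi eta : 'rV[F]_(n + 2).

Let nrm xi := forall X, bil B (X *m J) xi = 0.

Lemma row_free_rV xi : xi != 0 -> row_free xi.
Proof. by rewrite /row_free rank_rV => ->. Qed.

(** The [n + 1] rows of [J] and [xi] are independent and [B] is invertible, so their common
    orthogonal [K] has dimension 1; a non-zero [a] in it spans it. *)
Lemma normal_orthogonal_line xi a b : xi != 0 -> nrm xi -> nrm a -> nrm b ->
  bil B a xi = 0 -> bil B b xi = 0 -> a != 0 -> (b <= a)%MS.
Proof.
move=> xi0 Nxi Na Nb axi bxi a0.
have fJ : row_free (col_mx J xi).
  apply: (row_free_tangent_normal gu); last exact: row_free_rV.
  exact/normal_mxP.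
pose K := kermx (B *m (col_mx J xi)^T).
have rK : \rank K = 1%N.
  rewrite mxrank_ker eqmxMfull ?row_full_unit // mxrank_tr.
  by rewrite (eqP fJ) subnDl.
have inK v : nrm v -> bil B v xi = 0 -> (v <= K)%MS.
  move=> Nv vxi; apply/sub_kermxP; rewrite mulmxA tr_col_mx mul_mx_row.
  have /normal_mxP -> // := Nv.
  rewrite (_ : v *m B *m xi^T = 0) ?row_mx0 //.
  by apply/matrixP => i j; rewrite !ord1 [RHS]mxE.
apply: submx_trans (inK b Nb bxi) _.
have aK := inK a Na axi.
have := mxrank_leqif_eq aK; rewrite rK rank_rV a0 => -[_].
by rewrite eqxx => /esym/andP[].
Qed.

(** The normal space has rank 2, while [xi] has rank at most 1. *)
Lemma exists_normal_independent xi : exists2 eta, nrm eta & ~~ (eta <= xi)%MS.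
Proof.
have rK : \rank (kermx (B *m J^T)) = 2%N.
  rewrite mxrank_ker eqmxMfull ?row_full_unit // mxrank_tr.
  suff /eqP -> : row_free J by rewrite addKn.
  apply: inj_row_free => v vJ; apply: (can_inj (mulmxK gu)).
  by rewrite !mulmxA vJ !mul0mx.
have : ~~ (kermx (B *m J^T) <= xi)%MS.
  apply/negP => /mxrankS; rewrite rK => /leq_trans/(_ (rank_leq_row xi)).
  by rewrite ltnn.
move=> /row_subPn[i Ni]; exists (row i (kermx (B *m J^T))) => //.
apply/normal_mxP => //; rewrite -mulmxA; apply/sub_kermxP; exact: row_sub.
Qed.

Lemma det_tangent_normal (E : 'M[F]_n) xi eta : E \in unitmx ->
  nrm xi -> nrm eta -> xi != 0 -> ~~ (eta <= xi)%MS ->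
  \det (col_mx (E *m J) (col_mx xi eta) : 'M[F]_(n + 2)) != 0.
Proof.
move=> Eu Nxi Neta xi0 eta_xi.
rewrite -unitfE -unitmxE -row_free_unit.
apply: (@row_free_tangent_normal _ _ _ B (E *m J) _ (1 + 1)%N (col_mx xi eta)).
- by rewrite trmx_mul !mulmxA -!(mulmxA E) !mulmxA -(mulmxA E) -(mulmxA E)
    !unitmx_mul Eu unitmx_tr Eu andbT.
- have /normal_mxP N1 := Nxi; have /normal_mxP N2 := Neta.
  by rewrite trmx_mul mulmxA !mul_col_mx N1 // N2 // !mul0mx col_mx0.
apply: inj_row_free => v.
rewrite -[v]hsubmxK; move: (lsubmx v) (rsubmx v) => x y {v}.
rewrite mul_row_col => E0.
have y0 : y = 0.
  apply/eqP; apply: contraNT eta_xi => y0.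
  have yu : y \in unitmx.
    rewrite unitmxE unitfE det_mx11; apply: contraNneq y0 => y00.
    by apply/eqP/matrixP => i j; rewrite !ord1 y00 mxE.
  rewrite -(mulKmx yu eta) -[y *m eta](addKr (x *m xi)) E0 addr0.
  by rewrite mulmxN eqmx_opp mulmxA submxMl.
rewrite y0; suff -> : x = 0 by rewrite row_mx0.
move: E0; rewrite y0 mul0mx addr0 => E0.
by apply: (row_free_inj (row_free_rV xi0)); rewrite E0 mul0mx.
Qed.

End NormalPlane.

(** * Auxiliary facts on determinants, traces and partial derivatives *)

Lemma det_last_row_linear (F : comPzRingType) n (A : 'M[F]_(n, n + 2))
    (xi : 'rV[F]_(n + 2)) :
  exists l : 'rV[F]_(n + 2), forall eta,
    \det (col_mx A (col_mx xi eta) : 'M[F]_(n + 2)) = (l *m eta^T) 0 0.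
Proof.
pose T (eta : 'rV[F]_(n + 2)) : 'M[F]_(n + 2) := col_mx A (col_mx xi eta).
pose i0 : 'I_(n + 2) := rshift n (rshift 1 ord0 : 'I_2).
(* Cofactors along the last row do not see that row, so they may be computed with [eta = 0]. *)
exists (\row_j cofactor (T 0) i0 j) => eta.
rewrite -/(T eta) (expand_det_row _ i0) mxE; apply: eq_bigr => j _.
have -> : T eta i0 j = eta 0 j.
  exact: etrans (@col_mxEd F n 2 _ A (col_mx xi eta) _ j)
    (@col_mxEd F 1 1 _ xi eta 0 j).
rewrite mulrC; congr (_ * _); last by rewrite mxE.
rewrite mxE /cofactor; congr (_ * \det _); apply/matrixP => i k.
rewrite ![LHS]mxE ![RHS]mxE; case: splitP => // i2 Ei2.
rewrite ![LHS]mxE ![RHS]mxE; case: splitP => // z Ez.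
have /eqP[] := neq_lift i0 i; apply: val_inj.
by rewrite /= in Ei2 *; rewrite Ei2 Ez (ord1 z).
Qed.

Lemma mxtrace_sq_gt0 (R : realDomainType) n (L : 'M[R]_n) : L^T = L -> L != 0 ->
  0 < \tr (L *m L).
Proof.
move=> Ls L0.
have E : \tr (L *m L) = \sum_i \sum_j L i j ^+ 2.
  rewrite /mxtrace; apply: eq_bigr => i _; rewrite mxE; apply: eq_bigr => j _.
  by rewrite -{2}Ls mxE expr2.
rewrite lt_def E; apply/andP; split; last first.
  by apply: sumr_ge0 => i _; apply: sumr_ge0 => j _; apply: sqr_ge0.
apply: contraNneq L0 => S0; apply/eqP/matrixP => i j; rewrite mxE.
have /psumr_eq0P := S0 => /(_ (fun i _ => sumr_ge0 _ (fun j _ => sqr_ge0 _)) i isT).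
move/psumr_eq0P => /(_ (fun j _ => sqr_ge0 _) j isT)/eqP.
by rewrite sqrf_eq0 => /eqP.
Qed.

Lemma partial_comm (R : realType) n (U : set 'rV[R]_n) (f : 'rV[R]_n -> R)
    (i j : 'I_n) x : open U -> U x -> Ck 2 U f ->
  partial i (partial j f) x = partial j (partial i f) x.
Proof.
move=> oU Ux [_ fC]; have UN : nbhs x U by apply: open_nbhs_nbhs.
apply: (@derive_comm R 'rV[R]_n f (delta_mx 0 j) (delta_mx 0 i) x).
- apply: filterS UN => y Uy; split.
  + exact: (fC j).1.
  + exact: (fC i).1.
  + exact: ((fC j).2.2 i).1.
  + exact: ((fC i).2.2 j).1.
- exact: ((fC j).2.2 i).2.1.
- exact: ((fC i).2.2 j).2.1.
Qed.

Lemma partial_lin (R : realType) n m (w : 'I_m -> R) (f : 'I_m -> 'rV[R]_n -> R)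
    (i : 'I_n) x :
  (forall k, derivable (f k : 'rV[R]_n -> R^o) x (delta_mx 0 i)) ->
  partial i (fun y => \sum_k w k * f k y) x = \sum_k w k * partial i (f k) x.
Proof.
move=> df; rewrite /partial.
have -> : (fun y => \sum_k w k * f k y) =
    \sum_k (w k \*: (f k : 'rV[R]_n -> R^o)).
  by apply/funext => y; rewrite fct_sumE.
rewrite derive_sum; last by move=> k; apply: derivableZ.
by apply: eq_bigr => k _; rewrite deriveZ.
Qed.

(** * Pointwise properties of a semi-Riemannian metric *)

Section Gram.
Variables (R : realType) (n : nat) (M : manifold R n) (g : metric M).

Lemma gram_sym (c : chart M) p : dom c p -> (gram_at g c p)^T = gram_at g c p.
Proof.
move=> /(gram_sylvester g)[P Pu E]; rewrite /gram_at; set G := gram _ _ _ in E *.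
have : (P *m G *m P^T)^T = P *m G *m P^T by rewrite E tr_diag_mx.
rewrite !trmx_mul trmxK mulmxA => {}E.
have PTu : P^T \in unitmx by rewrite unitmx_tr.
by apply: (can_inj (mulKmx Pu)); apply: (can_inj (mulmxK PTu)).
Qed.

Lemma gram_unit (c : chart M) p : dom c p -> gram_at g c p \in unitmx.
Proof.
move=> /(gram_sylvester g)[P Pu E]; rewrite /gram_at; set G := gram _ _ _ in E *.
have : P *m G *m P^T \in unitmx.
  rewrite E unitmxE det_diag unitr_prod // => i _.
  by rewrite !mxE unitrX // unitrN unitr1.
by rewrite !unitmx_mul => /andP[/andP[]].
Qed.

Lemma gram_partial_sym (c : chart M) p i j l : dom c p ->
  partial l (fun y => gram g c y i j) (crd c p) =
  partial l (fun y => gram g c y j i) (crd c p).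
Proof.
(* Symmetry of the Gram matrix is known only on the chart image. That set is open, which is enough
   for derivatives. *)
move=> cp; apply: near_eq_derive.
have : nbhs (crd c p) (crd c @` dom c)%classic.
  by apply: open_nbhs_nbhs; split; [exact: img_open|exists p].
apply: filterS => _ [q cq <-].
by have /matrixP/(_ j i) := gram_sym cq; rewrite mxE.
Qed.

End Gram.

(** * Symmetry of the second fundamental form and of the total shear *)

Section Immersion.
Variables (R : realType) (n m : nat) (S : manifold R n) (M : manifold R m).
Variables (g : metric S) (gb : metric M) (Phi : isometric_immersion g gb).
Variables (c : chart S) (d : chart M).

Lemma local_rep_open : open (crd c @` (dom c `&` Phi @^-1` dom d))%classic.
Proof.
rewrite openE => _ [q [cq dq] <-] /=.
have cq' : (crd c @` dom c)%classic (crd c q) by exists q.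
have N1 : nbhs (crd c q) (crd c @` dom c)%classic.
  by apply: open_nbhs_nbhs; split => //; exact: img_open.
have N2 : nbhs (crd c q) (fun x => dom d (Phi (crdV c x))).
  have N : nbhs (Phi (crdV c (crd c q))) (dom d).
    by rewrite crdK//; apply: open_nbhs_nbhs; split => //; exact: dom_open.
  have C1 := crdV_continuous cq'.
  have C2 : {for crdV c (crd c q), continuous Phi} by exact: immersion_continuous.
  exact: continuous_comp C1 C2 _ N.
rewrite /interior; apply: filterS (filterI N1 N2) => _ [[r cr <-] dr].
by exists r => //; split => //; rewrite crdK in dr.
Qed.

Variables (p : S) (pc : dom c p) (pd : dom d (Phi p)).

Lemma local_rep_crd : local_rep Phi c d (crd c p) = crd d (Phi p).
Proof. by rewrite /local_rep /= crdK. Qed.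

(** Each component is the Hessian of a coordinate of the immersion plus the pull-back by [J] of a
    Christoffel form. The first is symmetric by equality of mixed partials, the second by vanishing
    torsion. *)
Lemma nabla_along_bil : exists2 Q : 'I_m -> 'M[R]_n,
  forall k, (Q k)^T = Q k &
  forall X Y k, nabla_along Phi c d p X
    (fun x => Y *m jac (local_rep Phi c d) x) 0 k = bil (Q k) X Y.
Proof.
set rep := local_rep Phi c d; set x0 := crd c p; set J := jac rep x0.
set U := (crd c @` (dom c `&` Phi @^-1` dom d))%classic.
have Ux : U x0 by exists p.
have repC k : Ck 2 U (fun x => rep x 0 k) by exact: immersion_smooth.
pose H k : 'M[R]_n := \matrix_(a, b)
  partial a (partial b (fun x => rep x 0 k)) x0.
pose C k : 'M[R]_m := \matrix_(a, b) christoffel (gram gb d) (rep x0) a b k.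
have bilE s (N : 'M[R]_s) u v :
    bil N u v = \sum_a \sum_b N a b * u 0 a * v 0 b.
  rewrite /bil !mxE exchange_big; apply: eq_bigr => b _ /=.
  rewrite mxE mulr_suml; apply: eq_bigr => a _.
  by rewrite !mxE; congr (_ * _); rewrite mulrC.
exists (fun k => H k + J *m C k *m J^T) => [k|X Y k].
  rewrite linearD /= !trmx_mul trmxK mulmxA; congr (_ + _).
    apply/matrixP => a b; rewrite !mxE.
    exact: partial_comm local_rep_open Ux (repC k).
  congr (_ *m _ *m _).
  apply/matrixP => a b; rewrite !mxE; apply: christoffel_torsion_free => i j l.
  by rewrite /rep local_rep_crd; exact: gram_partial_sym.
rewrite /nabla_along -/rep -/x0 -/J mxE.
have -> : bil (H k + J *m C k *m J^T) X Y =
    bil (H k) X Y + bil (C k) (X *m J) (Y *m J).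
  by rewrite /bil trmx_mul !mulmxA mulmxDr mulmxDl mxE !mulmxA.
congr (_ + _); last first.
  rewrite mxE bilE; apply: eq_bigr => a _; apply: eq_bigr => b _.
  by rewrite [C k _ _]mxE.
rewrite mxE bilE; apply: eq_bigr => a _; rewrite mxE.
have -> : (fun y => (Y *m jac rep y) 0 k) =
    (fun y => \sum_b Y 0 b * partial b (fun x => rep x 0 k) y).
  by apply/funext => y; rewrite mxE; apply: eq_bigr => b _; rewrite mxE.
rewrite partial_lin => [|b]; last exact: (((repC k).2 b).2.2 a).1.
rewrite mulr_sumr; apply: eq_bigr => b _.
by rewrite mxE [Y 0 b * _]mulrC mulrA [X 0 a * _]mulrC.
Qed.

(** Matrix of the normal projection, acting on the right. *)
Let Pm : 'M[R]_m := 1%:M - gram_at gb d (Phi p) *m (dPhi Phi c d p)^T *m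
  invmx (gram_at g c p) *m dPhi Phi c d p.

Lemma total_shear_bil (e : 'I_n -> 'rV[R]_n) :
  exists2 Q : 'I_m -> 'M[R]_n, forall k, (Q k)^T = Q k &
    forall X Y k, total_shear Phi c d p e X Y 0 k = bil (Q k) X Y.
Proof.
have [Q Qs QE] := nabla_along_bil.
have gs := gram_sym g pc.
exists (fun j => \sum_k Pm k j *: Q k -
   mean_curvature Phi c d p e 0 j *: gram_at g c p) => [j|X Y j].
  rewrite linearB linear_sum /= linearZ /= gs; congr (_ - _).
  by apply: eq_bigr => k _; rewrite linearZ /= Qs.
rewrite /total_shear mxE /bil mulmxBr mulmxBl [RHS]mxE; congr (_ + _).
  have -> : second_form Phi c d p X Y = nabla_along Phi c d p X
      (fun x => Y *m jac (local_rep Phi c d) x) *m Pm.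
    by rewrite /second_form /normal_part /Pm mulmxBr mulmx1 !mulmxA.
  rewrite mxE mulmx_sumr mulmx_suml summxE; apply: eq_bigr => k _.
  by rewrite QE -scalemxAr -scalemxAl [RHS]mxE mulrC.
rewrite [LHS]mxE [X in - X]mxE -scalemxAr -scalemxAl [RHS]mxE.
by rewrite [X in _ = - X]mxE mulrC.
Qed.

End Immersion.

(** * Umbilicity and the pair formed by the operator and [G] *)

Section Shear.
Variables (R : realType) (n m : nat) (S : manifold R n) (M : manifold R m).
Variables (g : metric S) (gb : metric M) (Phi : isometric_immersion g gb).
Variables (c : chart S) (d : chart M) (p : S).
Hypothesis n_gt0 : (0 < n)%N.
Hypotheses (pc : dom c p) (pd : dom d (Phi p)).
Variable e : 'I_n -> 'rV[R]_n.
Hypothesis he : oriented_orthonormal_frame g c p e.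

Local Notation gA := (gram_at g c p).
Local Notation B := (gram_at gb d (Phi p)).
Local Notation J := (dPhi Phi c d p).
Local Notation shear := (total_shear Phi c d p e).

Lemma immersion_gram : gA = J *m B *m J^T.
Proof. exact: immersion_isometric pc pd. Qed.

Lemma immersion_gram_unit : J *m B *m J^T \in unitmx.
Proof. by rewrite -immersion_gram gram_unit. Qed.

Lemma normalE xi : normal Phi c d p xi <-> xi *m B *m J^T = 0.
Proof. by apply: normal_mxP; exact: gram_sym. Qed.

Lemma normalB xi eta : normal Phi c d p xi -> normal Phi c d p eta ->
  normal Phi c d p (xi - eta).
Proof.
by move=> /normalE X0 /normalE E0; apply/normalE; rewrite !mulmxBl X0 E0 subrr.
Qed.

Lemma normalZ a xi : normal Phi c d p xi -> normal Phi c d p (a *: xi).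
Proof. by move=> /normalE X0; apply/normalE; rewrite -!scalemxAl X0 scaler0. Qed.

Lemma normal_part_decomp w : normal Phi c d p (normal_part Phi c d p w) /\
  exists X, w = X *m J + normal_part Phi c d p w.
Proof.
by apply: normal_partP; [exact: gram_unit|exact: immersion_gram|exact: gram_sym].
Qed.

Lemma second_form_normal X Y : normal Phi c d p (second_form Phi c d p X Y).
Proof. exact: (normal_part_decomp _).1. Qed.

Lemma total_shear_normal X Y : normal Phi c d p (shear X Y).
Proof.
apply: normalB; [exact: second_form_normal|apply/normalZ/normalZ/normalE].
rewrite !mulmx_suml big1 // => i _; apply/normalE; exact: second_form_normal.
Qed.

Lemma umbilicalP xi :
  umbilical Phi c d p xi <-> forall X Y, ambient_form Phi d p (shear X Y) xi = 0.
Proof.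
have nR : n%:R != 0 :> R by rewrite pnatr_eq0 -lt0n.
have E X Y : ambient_form Phi d p (shear X Y) xi =
    ambient_form Phi d p (second_form Phi c d p X Y) xi -
    tangent_form g c p X Y *
      ambient_form Phi d p (mean_curvature Phi c d p e) xi.
  by rewrite /ambient_form /total_shear bilDl bilNl bilZl.
split=> [[A AE [a Aa]] X Y|h0].
  have hE U V : ambient_form Phi d p (second_form Phi c d p U V) xi =
      a * tangent_form g c p U V.
    by rewrite -AE Aa mul_mx_scalar /tangent_form bilZl.
  rewrite E hE /mean_curvature /ambient_form bilZl bil_suml.
  rewrite (eq_bigr (fun=> a)) => [|i _].
    by rewrite sumr_const card_ord -[a *+ n]mulr_natl mulKf // mulrC subrr.
  by have := hE (e i) (e i); rewrite he.1 eqxx mulr1.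
(* The factor is forced: it is the trace of the shape operator divided by [n]. *)
pose a := ambient_form Phi d p (mean_curvature Phi c d p e) xi.
exists (a%:M); last by exists a.
move=> X Y; rewrite mul_mx_scalar /tangent_form bilZl.
by apply/esym/eqP; rewrite -subr_eq0 mulrC -E h0.
Qed.

Lemma shear_pair_neq0 A G : shear_pair Phi c d p e A G ->
  exists X Y, tangent_form g c p (X *m A) Y != 0.
Proof.
move=> [_ trA _ _]; apply: contrapT => N.
suff A0 : A = 0.
  move: trA; rewrite A0 mulmx0 mxtrace0 => /esym/eqP.
  by rewrite expf_eq0 pnatr_eq0 eqn0Ngt n_gt0.
apply: (can_inj (mulmxK (gram_unit g pc))); rewrite mul0mx.
apply: bil_eq0 => X Y; rewrite -bil_mulmxl; apply: contrapT => XY.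
by apply: N; exists X, Y; apply/eqP.
Qed.

Lemma umbilical_shear_pair A G xi : shear_pair Phi c d p e A G ->
  umbilical Phi c d p xi <-> ambient_form Phi d p G xi = 0.
Proof.
move=> AG; have [X [Y XY]] := shear_pair_neq0 AG.
have [_ _ _ hE] := AG.
split=> [/umbilicalP/(_ X Y)|Gxi].
  rewrite hE /ambient_form bilZl => /eqP.
  by rewrite mulf_eq0 (negbTE XY) => /eqP.
by apply/umbilicalP => U V; rewrite hE /ambient_form bilZl [bil _ _ _]Gxi mulr0.
Qed.

(** Equal tensor products give [G = k *: G'] and, if [G'] is non-zero, [A' = k *: A]; comparing the
    traces of the squares gives [k ^+ 2 = 1]. *)
Lemma shear_pair_unique A G A' G' : shear_pair Phi c d p e A G ->
  shear_pair Phi c d p e A' G' -> G' = G \/ G' = - G.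
Proof.
move=> AG AG'; have [X [Y XY]] := shear_pair_neq0 AG.
have [_ trA _ hE] := AG; have [_ trA' _ hE'] := AG'.
have E U V := etrans (esym (hE U V)) (hE' U V).
pose k := (tangent_form g c p (X *m A) Y)^-1 * tangent_form g c p (X *m A') Y.
have Gk : G = k *: G' by rewrite /k -scalerA -E scalerA mulVf // scale1r.
have [G'0|G'0] := eqVneq G' 0.
  by left; rewrite Gk G'0 scaler0.
have A'k : A' = k *: A.
  apply/eqP; rewrite -subr_eq0; apply/eqP.
  apply: (can_inj (mulmxK (gram_unit g pc))); rewrite mul0mx.
  apply: bil_eq0 => U V; rewrite -bil_mulmxl mulmxBr -scalemxAr bilDl bilNl bilZl.
  apply/eqP; rewrite subr_eq0; apply/eqP.
  have /eqP := E U V; rewrite Gk scalerA -subr_eq0 -scalerBl scaler_eq0.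
  by rewrite (negbTE G'0) orbF subr_eq0 => /eqP; rewrite mulrC => ->.
have : k ^+ 2 = 1.
  have n2 : n%:R ^+ 2 != 0 :> R by rewrite expf_neq0 // pnatr_eq0 -lt0n.
  apply: (mulIf n2); rewrite mul1r -[in RHS]trA' A'k.
  by rewrite -scalemxAl -scalemxAr !mxtraceZ trA mulrA.
move/eqP; rewrite sqrf_eq1 => /orP[]/eqP k1; [left|right]; rewrite Gk k1.
  by rewrite scale1r.
by rewrite scaleN1r opprK.
Qed.

(* If E has the frame e as rows, then E g E^T = 1, so K g^-1 is similar to    *)
(* the symmetric matrix E K E^T.                                              *)
Lemma trace_sq_gram_gt0 (K : 'M[R]_n) : K^T = K -> K != 0 ->
  0 < \tr (K *m invmx gA *m (K *m invmx gA)).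
Proof.
move=> Ks K0; pose E := \matrix_i e i.
have EE : E *m gA *m E^T = 1%:M.
  apply/matrixP => i j; rewrite -bil_delta [RHS]mxE -he.1.
  transitivity (bil gA (delta_mx 0 i *m E) (delta_mx 0 j *m E)).
    by rewrite /bil trmx_mul !mulmxA.
  by rewrite -!rowE !rowK.
have Eu : E \in unitmx.
  by have [] := mulmx1_unit EE; rewrite unitmx_mul => /andP[].
have gu := gram_unit g pc.
have gV : invmx gA = E^T *m E.
  apply: (can_inj (mulKmx gu)); rewrite mulmxV // mulmxA; apply/esym/mulmx1C.
  by rewrite mulmxA.
pose L := E *m K *m E^T.
have -> : \tr (K *m invmx gA *m (K *m invmx gA)) = \tr (L *m L).
  have -> : L *m L = E *m (K *m E^T *m E *m K *m E^T) by rewrite /L !mulmxA.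
  by rewrite [RHS]mxtrace_mulC gV !mulmxA.
apply: mxtrace_sq_gt0; first by rewrite /L !trmx_mul trmxK Ks mulmxA.
apply: contraNneq K0 => L0; apply/eqP.
have ETu : E^T \in unitmx by rewrite unitmx_tr.
apply: (can_inj (mulKmx Eu)); apply: (can_inj (mulmxK ETu)).
by rewrite -/L L0 mulmx0 mul0mx.
Qed.

Lemma shear_pair_exists :
  (forall X Y X0 Y0, shear X0 Y0 != 0 -> (shear X Y <= shear X0 Y0)%MS) ->
  exists A G, shear_pair Phi c d p e A G.
Proof.
move=> line.
have gs := gram_sym g pc.
have [Q Qs QE] := total_shear_bil pc pd e.
have [[X0 [Y0 h0]]|h0] := pselect (exists X Y, shear X Y != 0); last first.
  (* With zero shear, [G = 0] and any self-adjoint operator of the right trace will do; this one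
     squares to [n] times the identity. *)
  exists ((Num.sqrt n%:R)%:M), 0; split.
  - move=> X Y; rewrite !mul_mx_scalar /tangent_form bilZl [RHS]bilC // bilZl.
    by congr (_ * _); exact: bilC.
  - by rewrite -scalar_mxM mxtrace_scalar -expr2 sqr_sqrtr ?ler0n //
      -[LHS]mulr_natl expr2.
  - by apply/normalE; rewrite !mul0mx.
  - move=> X Y; rewrite scaler0; apply: contrapT => /eqP XY.
    by apply: h0; exists X, Y.
have hN X Y := line X Y X0 Y0 h0.
have NN := total_shear_normal X0 Y0; set N := shear X0 Y0 in h0 hN NN.
have [j Nj] : exists j, N 0 j != 0.
  apply: contrapT => Nj; move/eqP: h0; apply; apply/rowP => j; rewrite [RHS]mxE.
  by apply: contrapT => /eqP ?; apply: Nj; exists j.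
(* The scalar factor of the shear along [N] is read off a component where [N] is non-zero. *)
pose K := (N 0 j)^-1 *: Q j.
have KE X Y : shear X Y = bil K X Y *: N.
  have /sub_rVP[a hE] := hN X Y; rewrite hE; congr (_ *: _).
  rewrite /bil /K -scalemxAr -scalemxAl [RHS]mxE.
  by rewrite -[(_ *m _) 0 0]/(bil (Q j) X Y) -QE hE [X in _ * X]mxE mulrC mulfK.
have Ks : K^T = K by rewrite /K linearZ /= Qs.
have K0 : K != 0.
  by apply: contraNneq h0 => K0; rewrite /N KE K0 /bil mulmx0 mul0mx mxE scale0r.
have gu := gram_unit g pc.
have t0 := trace_sq_gram_gt0 Ks K0; set A0 := K *m invmx gA in t0.
(* This scale brings the trace of the square to [n ^+ 2]; [N] is divided by [l] to compensate. *)
pose l : R := n%:R / Num.sqrt (\tr (A0 *m A0)).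
have l0 : l != 0.
  by rewrite mulf_neq0 ?pnatr_eq0 -?lt0n // invr_neq0 // sqrtr_eq0 -ltNge.
have A0E X Y : tangent_form g c p (X *m A0) Y = bil K X Y.
  by rewrite /tangent_form bil_mulmxl /A0 mulmxKV.
exists (l *: A0), (l^-1 *: N); split.
- move=> X Y; rewrite -!scalemxAr /tangent_form bilZl.
  rewrite [RHS]bilC // bilZl; congr (_ * _).
  exact: etrans (A0E X Y) (etrans (bilC _ _ Ks) (esym (A0E Y X))).
- rewrite -scalemxAl -scalemxAr !mxtraceZ mulrA -expr2 /l expr_div_n.
  by rewrite sqr_sqrtr ?ltW // divfK // gt_eqF.
- exact: normalZ.
- move=> X Y; rewrite KE -scalemxAr /tangent_form bilZl -A0E /tangent_form.
  by rewrite scalerA mulrAC mulfV // mul1r.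
Qed.

End Shear.

(** * The Hodge dual in the normal plane *)

Section Hodge.
Variables (R : realType) (n : nat) (S : manifold R n) (M : manifold R (n + 2)).
Variables (g : metric S) (gb : metric M) (Phi : isometric_immersion g gb).
Variables (c : chart S) (d : chart M) (p : S).
Hypotheses (pc : dom c p) (pd : dom d (Phi p)).
Variable e : 'I_n -> 'rV[R]_n.

Local Notation B := (gram_at gb d (Phi p)).
Local Notation J := (dPhi Phi c d p).

Lemma hodge_dual_exists xi : exists s, is_hodge_dual Phi c d p e xi s.
Proof.
have [l lE] := det_last_row_linear ((\matrix_i e i) *m J) xi.
(* [w] represents the volume functional on the whole ambient space. Its tangential part pairs to
   zero with normal vectors, so its normal part represents the same functional there. *)
pose w := Num.sqrt `|\det B| *: l *m invmx B.
have [N [X wE]] := normal_part_decomp pc pd w.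
exists (normal_part Phi c d p w); split=> // eta Neta.
have : ambient_form Phi d p w eta = normal_volume Phi c d p e xi eta.
  rewrite /normal_volume lE /ambient_form /bil mulmxKV ?gram_unit //.
  by rewrite -scalemxAl mxE.
by rewrite [in LHS]wE /ambient_form bilDl [X in X + _]Neta add0r.
Qed.

Lemma hodge_dual_orthogonal xi s : normal Phi c d p xi ->
  is_hodge_dual Phi c d p e xi s -> ambient_form Phi d p xi s = 0.
Proof.
move=> Nxi [_ sE]; rewrite /ambient_form bilC ?gram_sym //.
rewrite [LHS](sE _ Nxi) /normal_volume.
apply/eqP; rewrite mulf_eq0; apply/orP; right; apply/eqP.
apply: (@determinant_alternate _ _ _ (rshift n (lshift 1 (ord0 : 'I_1)))
  (rshift n (rshift 1 (ord0 : 'I_1)))) => [|j].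
  by rewrite (inj_eq (@rshift_inj _ _)).
transitivity (xi 0 j).
  exact: etrans (@col_mxEd R n 2 _ _ _ _ j) (@col_mxEu R 1 1 _ xi xi 0 j).
exact: esym (etrans (@col_mxEd R n 2 _ _ _ _ j) (@col_mxEd R 1 1 _ xi xi 0 j)).
Qed.

(** The normal volume of [xi] and an independent normal [eta] is non-zero, and it equals the pairing
    of [s] with [eta]. *)
Lemma hodge_dual_neq0 xi s : oriented_orthonormal_frame g c p e ->
  normal Phi c d p xi -> xi != 0 -> is_hodge_dual Phi c d p e xi s -> s != 0.
Proof.
move=> [_ Epos] Nxi xi0 [_ sE].
have Bs := gram_sym gb pd; have Bu := gram_unit gb pd.
have gu := immersion_gram_unit pc pd.
have [eta Neta eta_xi] := exists_normal_independent Bs Bu gu xi.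
have Eu : \matrix_i e i \in unitmx by rewrite unitmxE unitfE gt_eqF.
have D := det_tangent_normal Bs gu Eu Nxi Neta xi0 eta_xi.
apply: contraNneq D => s0; have /eqP := sE _ Neta.
rewrite s0 /ambient_form /bil !mul0mx mxE eq_sym mulf_eq0 => /orP[|//].
rewrite sqrtr_eq0 normr_le0; move: Bu; rewrite unitmxE unitfE => /negbTE ->.
by [].
Qed.

End Hodge.

Theorem corollary5 (R : realType) (n : nat) (n_gt0 : (0 < n)%N)
    (S : manifold R n) (M : manifold R (n + 2))
    (g : metric S) (gb : metric M) (g_pos : riemannian g)
    (Phi : isometric_immersion g gb)
    (p : S) (c : chart S) (d : chart M) (pc : dom c p) (pd : dom d (Phi p))
    (e : 'I_n -> 'rV[R]_n) (he : oriented_orthonormal_frame g c p e)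
    (humb : exists xi : 'rV[R]_(n + 2),
        [/\ xi != 0, normal Phi c d p xi & umbilical Phi c d p xi]) :
  [/\ exists A G, shear_pair Phi c d p e A G,
      forall A G A' G', shear_pair Phi c d p e A G ->
        shear_pair Phi c d p e A' G' -> G' = G \/ G' = - G &
      forall A G, shear_pair Phi c d p e A G ->
        (G != 0 -> exists2 s, is_hodge_dual Phi c d p e G s &
           forall xi : 'rV[R]_(n + 2), xi != 0 -> normal Phi c d p xi ->
             (umbilical Phi c d p xi <-> (xi == s)%MS)) /\
        (G = 0 -> totally_umbilical Phi c d p)].
Proof.
set B := gram_at gb d (Phi p); set J := dPhi Phi c d p.
have Bs : B^T = B by apply: gram_sym.
have Bu : B \in unitmx by apply: gram_unit.
have gu : J *m B *m J^T \in unitmx by apply: immersion_gram_unit pc pd.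
have line := normal_orthogonal_line Bs Bu gu.
split.
- have [xi [xi0 Nxi /umbilicalP]] := humb.
  move=> /(_ e n_gt0 he) hxi.
  have Nh := total_shear_normal pc pd e.
  apply: (shear_pair_exists n_gt0 pc pd he) => X Y X0 Y0.
  exact: line xi0 Nxi (Nh X0 Y0) (Nh X Y) (hxi X0 Y0) (hxi X Y).
- move=> A G A' G'; exact: shear_pair_unique.
move=> A G AG; have [_ _ NG _] := AG.
have umb xi := umbilical_shear_pair n_gt0 pc he xi AG.
split; last first.
  move=> G0 xi _; apply/umb.
  by rewrite G0 /ambient_form /bil !mul0mx mxE.
move=> G0; have [s Gs] := hodge_dual_exists pc pd e G.
exists s => // xi xi0 Nxi.
have s0 := hodge_dual_neq0 pc pd he NG G0 Gs.
have Gs0 : bil B s G = 0.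
  by rewrite bilC //; apply: hodge_dual_orthogonal Gs.
apply: (iff_trans (umb xi)).
(* Both [xi] and [s] are non-zero vectors of the normal line orthogonal to [G], so each spans the
   other. *)
split=> [Gxi|/andP[/sub_rVP[k ->] _]].
  have xiG : bil B xi G = 0 by rewrite bilC.
  apply/andP; split.
    exact: line G0 NG Gs.1 Nxi Gs0 xiG s0.
  exact: line G0 NG Nxi Gs.1 xiG Gs0 xi0.
by rewrite /ambient_form bilC // bilZl [bil _ _ _]Gs0 mulr0.
Qed.
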